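(* There exist exactly 6 isomorphism classes of spherical buildings of type $A_2$ and order 2 with 3 chambers missing.
   Context: Let $H$ be the incidence graph of the Fano plane (the projective plane over the field with two elements): it has 14 vertices, is 3-regular, bipartite, of girth 6, and it is the unique spherical building of type $A_2$ and order 2; its chambers are its edges. A spherical building of type $A_2$ and order 2 with $n$ chambers missing is a graph isomorphic to one obtained from $H$ by deleting $n$ distinct open edges (keeping all vertices), with the standing requirement that the resulting graph has no boundary, i.e. every vertex has valency at least 2 (equivalently, the $n$ deleted edges are pairwise disjoint). Isomorphism means graph isomorphism. *)

(* Defs.v *)
From mathcomp Require Import all_boot all_order all_algebra.

Set Implicit Arguments.
Unset Strict Implicit.
Unset Printing Implicit Defensive.

Import GRing.Theory.

Record sgraph := SGraph {
  vertex :> finType;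
  adj : rel vertex;
  adj_sym : symmetric adj;
  adj_irr : irreflexive adj
}.

Definition sgraph_iso (G H : sgraph) : Prop :=
  exists2 f : G -> H, bijective f & forall x y, adj (f x) (f y) = adj x y.

Definition valency (G : sgraph) (x : G) : nat := #|[set y | adj x y]|.

Definition edges (G : sgraph) : {set {set G}} :=
  [set [set x; y] | x in G, y in G & adj x y].

Section DelEdges.
Variables (G : sgraph) (D : {set {set G}}).

Definition del_adj : rel G := fun x y => adj x y && ([set x; y] \notin D).

Lemma del_adj_sym : symmetric del_adj.
Proof. by move=> x y; rewrite /del_adj adj_sym setUC. Qed.

Lemma del_adj_irr : irreflexive del_adj.
Proof. by move=> x; rewrite /del_adj adj_irr. Qed.

Definition del_edges : sgraph := SGraph del_adj_sym del_adj_irr.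

End DelEdges.

Section IncidenceGraph.
Variables (P L : finType) (inc : P -> L -> bool).

Definition inc_adj : rel (P + L) := fun x y =>
  match x, y with
  | inl p, inr l => inc p l
  | inr l, inl p => inc p l
  | _, _ => false
  end.

Lemma inc_adj_sym : symmetric inc_adj.
Proof. by move=> [p|l] [p'|l']. Qed.

Lemma inc_adj_irr : irreflexive inc_adj.
Proof. by move=> [p|l]. Qed.

Definition incidence_graph : sgraph := SGraph inc_adj_sym inc_adj_irr.

End IncidenceGraph.

(* The d-dimensional subspaces of F_2^3.  Every row space contains exactly one
   matrix A with <<A>> = A as a generator, so these matrices represent each
   subspace once. *)
Definition subspaceF2 (d : nat) : finType :=
  {A : 'M['F_2]_3 | (<<A>>%MS == A) && (\rank A == d)}.

Definition fano_graph : sgraph :=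
  @incidence_graph (subspaceF2 1) (subspaceF2 2)
    (fun p l => (val p <= val l)%MS).

(* The chambers of the building are the edges of fano_graph; the valency
   condition says that the remaining graph has no boundary. *)
Definition A2_building_missing (n : nat) (G : sgraph) : Prop :=
  exists D : {set {set fano_graph}},
    [/\ D \subset edges fano_graph, #|D| = n,
        forall x : del_edges D, 2 <= valency x
      & sgraph_iso G (del_edges D)].

(* Main.v *)
(* The incidence graph of the Fano plane is the Heawood graph, the 14-cycle with
   the chords of the LCF code [5, -5]^7; for this labelling its automorphisms
   are computed as tables.  They are transitive on edges, and the stabiliser of
   an edge is transitive on the edges at each given distance from it, so every
   admissible triple of edges can be moved to start with {0, 1} and one of a
   few second edges, and then to one of six representatives.  The number
   [weight], which sees how the six vertices of valency 2 are attached,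
   separates the six resulting graphs. *)

Require Import Defs.
From mathcomp Require Import all_boot.
From mathcomp Require Import all_algebra.

Set Implicit Arguments.
Unset Strict Implicit.
Unset Printing Implicit Defensive.

(** * Isomorphisms of graphs and a numerical invariant *)

Lemma sgraph_iso_sym (G H : sgraph) : sgraph_iso G H -> sgraph_iso H G.
Proof.
move=> [f [g fK gK] fP]; exists g; first by exists f.
by move=> x y; rewrite -fP !gK.
Qed.

Lemma sgraph_iso_trans (G H K : sgraph) :
  sgraph_iso G H -> sgraph_iso H K -> sgraph_iso G K.
Proof.
move=> [f f_bij fP] [g g_bij gP]; exists (g \o f); first exact: bij_comp.
by move=> x y; rewrite /= gP fP.
Qed.

Lemma card_bij_set (S T : finType) (f : S -> T) (p : pred S) (q : pred T) :
  bijective f -> (forall x, q (f x) = p x) ->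
  #|[set y | q y]| = #|[set x | p x]|.
Proof.
move=> f_bij pq; rewrite -(card_imset _ (bij_inj f_bij)).
congr #|pred_of_set _|.
case: f_bij => g fK gK; apply/setP => y; rewrite inE.
apply/idP/imsetP => [qy|[x]]; first by exists (g y); rewrite ?gK // inE -pq gK.
by rewrite inE -pq => ? ->.
Qed.

Lemma valency_iso (G H : sgraph) (f : G -> H) :
  bijective f -> (forall x y, adj (f x) (f y) = adj x y) ->
  forall x, valency (f x) = valency x.
Proof. by move=> f_bij fP x; apply: (card_bij_set f_bij) => y; apply: fP. Qed.

(* The cube is ad hoc: with a square instead of a cube, two of the six graphs
   would have the same weight. *)
Definition weight (G : sgraph) : nat :=
  \sum_(x : G) valency x * #|[set y | adj x y && (valency y == 2)]| ^ 3.

Lemma weight_iso (G H : sgraph) : sgraph_iso G H -> weight G = weight H.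
Proof.
move=> [f f_bij fP]; rewrite /weight [RHS](reindex f); last exact: onW_bij.
apply: eq_bigr => x _; rewrite (valency_iso f_bij fP); congr (_ * _ ^ _).
by apply/esym/(card_bij_set f_bij) => y; rewrite fP (valency_iso f_bij fP).
Qed.

(** * Transport of edge deletions along isomorphisms *)

Lemma del_edges_iso (G H : sgraph) (f : G -> H) (D : {set {set G}}) :
  bijective f -> (forall x y, adj (f x) (f y) = adj x y) ->
  sgraph_iso (del_edges D) (del_edges [set f @: E | E : {set G} in D]).
Proof.
move=> f_bij fP; have f_inj := bij_inj f_bij.
exists f => // x y; rewrite /adj /= /del_adj fP; congr (_ && ~~ _).
have -> : [set f x; f y] = f @: [set x; y] by rewrite imsetU1 imset_set1.
by rewrite mem_imset //; apply: imset_inj.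
Qed.

(** [A2_building_missing] is the case [H = fano_graph]; the host graph is a parameter so that the
    problem can be moved to [heawood]. *)
Definition missing (H : sgraph) (n : nat) (G : sgraph) : Prop :=
  exists D : {set {set H}},
    [/\ D \subset edges H, #|D| = n,
        forall x : del_edges D, 2 <= valency x
      & sgraph_iso G (del_edges D)].

Lemma missing_iso (H K : sgraph) (n : nat) (G : sgraph) :
  sgraph_iso H K -> missing H n G -> missing K n G.
Proof.
move=> [f f_bij fP] [D [D_edges D_n D_val GD]].
have D_iso := del_edges_iso D f_bij fP.
exists [set f @: E | E : {set H} in D]; split.
- apply/subsetP => _ /imsetP [E /(subsetP D_edges) /imset2P [x y _ yP ->] ->].
  move: yP; rewrite inE /= => xy.
  rewrite imsetU1 imset_set1; apply/imset2P; exists (f x) (f y) => //.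
  by rewrite inE /= fP.
- by rewrite card_imset //; apply/imset_inj/bij_inj.
- case: D_iso => g [h gK hK] gP y; rewrite -(hK y) (@valency_iso _ _ g) //.
  by exists h.
- exact: sgraph_iso_trans D_iso.
Qed.

(** * The Heawood graph on the numbers below 14 *)

(** Read from an even [x] to an odd [y]: the differences 1 and 13 are the steps along the cycle, 5
    is the chord. Adding 14 first avoids truncated subtraction. *)
Definition arc_LCF (x y : nat) : bool := (y + 14 - x) %% 14 \in [:: 1; 5; 13].

Definition heawood_adj (x y : nat) : bool :=
  if odd x then ~~ odd y && arc_LCF y x else odd y && arc_LCF x y.

Lemma heawood_adj_sym : symmetric heawood_adj.
Proof. by move=> x y; rewrite /heawood_adj; case: (odd x); case: (odd y). Qed.

Lemma heawood_adj_irr : irreflexive heawood_adj.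
Proof. by move=> x; rewrite /heawood_adj; case: (odd x). Qed.

Definition heawood : sgraph :=
  @SGraph 'I_14 (relpre val heawood_adj)
    (fun x y => heawood_adj_sym x y) (fun x => heawood_adj_irr x).

Definition vertices : seq nat := iota 0 14.

Lemma mem_vertices (x : 'I_14) : val x \in vertices.
Proof. by rewrite mem_iota ltn_ord. Qed.

Lemma card_vertices (p : pred nat) :
  #|[set x : 'I_14 | p x]| = count p vertices.
Proof.
rewrite cardsE cardE /enum_mem size_filter -enumT /vertices -val_enum_ord.
by rewrite count_map.
Qed.

(** Two vertices share at most one of their three neighbours, as the girth is 6. Hence any map out
    of [heawood] under which adjacency is preserved and reflected is injective. *)
Lemma heawood_twin_free (x y : 'I_14) :
  (forall z : 'I_14, heawood_adj x z = heawood_adj y z) -> x = y.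
Proof.
move=> xy; apply/val_inj/eqP.
have /allP/(_ _ (mem_vertices x))/allP/(_ _ (mem_vertices y)) /implyP :
  all (fun x => all (fun y =>
    all (fun z => heawood_adj x z == heawood_adj y z) vertices ==> (x == y))
    vertices) vertices by vm_compute.
apply; apply/allP => z; rewrite mem_iota => /= z_lt.
by apply/eqP; exact: (xy (Ordinal z_lt)).
Qed.

(** * Sets of edges as lists of increasing pairs of numbers *)

Definition orient (e : nat * nat) : nat * nat :=
  if e.1 < e.2 then e else (e.2, e.1).

Definition arcs : seq (nat * nat) :=
  [seq e <- allpairs pair vertices vertices
    | (e.1 < e.2) && heawood_adj e.1 e.2].

Definition chamber (e : nat * nat) : {set heawood} :=
  [set inord e.1; inord e.2].

Definition chambers (t : seq (nat * nat)) : {set {set heawood}} :=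
  [set:: map chamber t].

Lemma mem_arcs (x y : nat) :
  ((x, y) \in arcs) = [&& x < y, y < 14 & heawood_adj x y].
Proof.
have -> : ((x, y) \in arcs) =
    [&& x < y, heawood_adj x y & (x, y) \in allpairs pair vertices vertices].
  by rewrite mem_filter -andbA.
rewrite [heawood_adj x y && _]andbC; case xy: (x < y) => //.
rewrite !andTb; congr (_ && _).
apply/allpairsP/idP => [[[a b] /= [_ + [_ ->]]]|y_lt].
  by rewrite mem_iota.
by exists (x, y); rewrite !mem_iota /= (ltn_trans xy).
Qed.

Lemma orient_arcs (x y : nat) : x < 14 -> y < 14 -> heawood_adj x y ->
  orient (x, y) \in arcs.
Proof.
move=> x_lt y_lt xy; rewrite /orient /=; case: ltngtP => [lt|lt|eq_xy].
- by rewrite mem_arcs lt y_lt xy.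
- by rewrite mem_arcs lt x_lt heawood_adj_sym xy.
- by rewrite eq_xy heawood_adj_irr in xy.
Qed.

Lemma chamber_orient (e : nat * nat) : chamber (orient e) = chamber e.
Proof. by rewrite /orient; case: ifP => // _; rewrite /chamber setUC. Qed.

Lemma eq_set2 (T : finType) (a b c d : T) :
  ([set a; b] == [set c; d]) =
  ((a == c) && (b == d)) || ((a == d) && (b == c)).
Proof.
apply/eqP/idP => [abcd|/orP [] /andP [/eqP -> /eqP ->] //]; last exact: setUC.
have : a \in [set c; d] by rewrite -abcd set21.
have : b \in [set c; d] by rewrite -abcd set22.
have : c \in [set a; b] by rewrite abcd set21.
have : d \in [set a; b] by rewrite abcd set22.
rewrite !inE ![c == _]eq_sym ![d == _]eq_sym.
by case: (a == c); case: (a == d); case: (b == c); case: (b == d).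
Qed.

Lemma chamber_inj : {in arcs &, injective chamber}.
Proof.
move=> [x y] [x' y']; rewrite !mem_arcs.
move=> /and3P [xy y_lt _] /and3P [xy' y'_lt _].
move/eqP; rewrite /chamber eq_set2 -!val_eqE /= !inordK //;
  [|exact: ltn_trans y'_lt|exact: ltn_trans y_lt].
case/orP=> /andP [/eqP xE /eqP yE]; first by rewrite xE yE.
by move: xy; rewrite xE yE ltnNge ltnW.
Qed.

Lemma mem_chambers (t : seq (nat * nat)) (e : nat * nat) :
  {subset t <= arcs} -> e \in arcs -> (chamber e \in chambers t) = (e \in t).
Proof.
move=> t_arcs eP; rewrite /chambers inE; apply/mapP/idP => [[e' e't]|et].
  by move/(chamber_inj eP (t_arcs _ e't)) ->.
by exists e.
Qed.

(** This and the [nat_] versions below mirror the graph notions on numbers and lists, where they can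
    be evaluated. *)
Definition del_arcs (t : seq (nat * nat)) : rel nat := fun x y =>
  heawood_adj x y && (orient (x, y) \notin t).

Lemma adj_del_chambers (t : seq (nat * nat)) : {subset t <= arcs} ->
  forall x y : del_edges (chambers t), adj x y = del_arcs t (val x) (val y).
Proof.
move=> t_arcs x y; rewrite /adj /= /del_adj /del_arcs /adj /=.
case xy: (heawood_adj _ _) => //=.
rewrite -mem_chambers ?orient_arcs ?ltn_ord // chamber_orient.
by rewrite /chamber /= !inord_val.
Qed.

Definition nat_valency (t : seq (nat * nat)) (x : nat) : nat :=
  count (del_arcs t x) vertices.

Lemma valency_del_chambers (t : seq (nat * nat)) : {subset t <= arcs} ->
  forall x : del_edges (chambers t), valency x = nat_valency t (val x).
Proof.
move=> t_arcs x; rewrite /nat_valency -card_vertices /valency.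
by apply: eq_card => y; rewrite !inE adj_del_chambers.
Qed.

Definition nat_weight (t : seq (nat * nat)) : nat :=
  sumn [seq nat_valency t x *
    count (fun y => del_arcs t x y && (nat_valency t y == 2)) vertices ^ 3
    | x <- vertices].

Lemma weight_del_chambers (t : seq (nat * nat)) : {subset t <= arcs} ->
  weight (del_edges (chambers t)) = nat_weight t.
Proof.
move=> t_arcs; rewrite /nat_weight sumnE big_map /vertices.
rewrite -[iota 0 14]/(index_iota 0 14) big_mkord.
apply: eq_bigr => x _; rewrite valency_del_chambers //; congr (_ * _ ^ _).
rewrite -card_vertices; apply: eq_card => y.
by rewrite !inE adj_del_chambers // valency_del_chambers.
Qed.

Lemma edges_chambers (D : {set {set heawood}}) : D \subset edges heawood ->
  exists t, [/\ {subset t <= arcs}, size t = #|D| & D = chambers t].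
Proof.
move=> /subsetP D_edges.
suff /(_ (enum D)) [|t t_arcs tD] : forall s : seq {set heawood},
    {subset s <= edges heawood} ->
    exists2 t, {subset t <= arcs} & map chamber t = s.
- by move=> E; rewrite mem_enum; apply: D_edges.
- exists t; split=> //; first by rewrite -(size_map chamber) tD cardE.
  by apply/setP => E; rewrite /chambers tD inE mem_enum.
elim=> [|E s IHs] sP; first by exists [::].
have [|t t_arcs <-] := IHs.
  by move=> F Fs; apply: sP; rewrite inE Fs orbT.
have /imset2P [x y _ yP ->] : E \in edges heawood by rewrite sP ?mem_head.
exists (orient (val x, val y) :: t); last first.
  by rewrite /= chamber_orient /chamber !inord_val.
move: yP; rewrite inE /= => xy.
by move=> e; rewrite inE => /orP [/eqP ->|/t_arcs //]; apply: orient_arcs.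
Qed.

(** * Automorphisms of the Heawood graph and their action on edges *)

(* Partial automorphisms, as tables of the images of 0, 1, 2, ...  Since
   consecutive vertices are adjacent, at most 336 tables survive each step. *)
Definition extend (ss : seq (seq nat)) : seq (seq nat) :=
  [seq rcons s y | s <- ss, y <- [seq y <- vertices | y \notin s &
    all (fun i => heawood_adj (nth 0 s i) y == heawood_adj i (size s))
      (iota 0 (size s))]].

(** Every table is checked afresh, so nothing has to be proved about [extend]. Injectivity is left
    to [heawood_twin_free]. *)
Definition is_automorphism (s : seq nat) : bool :=
  all (fun x => (nth 0 s x < 14) && all (fun y =>
    heawood_adj (nth 0 s x) (nth 0 s y) == heawood_adj x y) vertices) vertices.

Definition automorphisms : seq (seq nat) :=
  [seq s <- iter 14 extend [:: [::]] | is_automorphism s].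

Definition move (s : seq nat) (e : nat * nat) : nat * nat :=
  orient (nth 0 s e.1, nth 0 s e.2).

Lemma del_chambers_move (s : seq nat) (t : seq (nat * nat)) :
  s \in automorphisms -> {subset t <= arcs} ->
  [/\ {subset map (move s) t <= arcs},
      #|chambers (map (move s) t)| = #|chambers t| &
      sgraph_iso (del_edges (chambers t))
                 (del_edges (chambers (map (move s) t)))].
Proof.
rewrite mem_filter => /andP [/allP s_aut _] t_arcs.
have s_lt x : x < 14 -> nth 0 s x < 14.
  by move=> x_lt; have /s_aut /andP [] : x \in vertices by rewrite mem_iota.
have s_adj x y : x < 14 -> y < 14 ->
    heawood_adj (nth 0 s x) (nth 0 s y) = heawood_adj x y.
  move=> x_lt y_lt; have /s_aut /andP [_ /allP] : x \in vertices.
    by rewrite mem_iota.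
  by move=> /(_ y); rewrite mem_iota => /(_ y_lt) /eqP.
have st_arcs : {subset map (move s) t <= arcs}.
  move=> _ /mapP [[x y] /t_arcs + ->]; rewrite mem_arcs => /and3P [xy y_lt xyP].
  have x_lt := ltn_trans xy y_lt.
  by apply: orient_arcs; rewrite ?s_lt ?s_adj.
pose f (x : heawood) : heawood := inord (nth 0 s (val x)).
have fE (x : heawood) : val (f x) = nth 0 s (val x).
  exact: inordK (s_lt _ (ltn_ord x)).
have fP x y : adj (f x) (f y) = adj x y.
  by rewrite /adj /= !fE s_adj ?ltn_ord.
have f_bij : bijective f.
  have f_inj : injective f; last exact: injF_bij f_inj.
  move=> x y xy; apply: heawood_twin_free => z.
  by have := fP x z; rewrite xy fP => yz; apply: esym.
have -> : chambers (map (move s) t) =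
    [set f @: E | E : {set heawood} in chambers t].
  have moveE e : e \in t -> chamber (move s e) = f @: chamber e.
    case: e => x y /t_arcs; rewrite mem_arcs => /and3P [xy y_lt _].
    have x_lt := ltn_trans xy y_lt.
    by rewrite chamber_orient /chamber imsetU1 imset_set1 /f /= !inordK.
  apply/setP => E; rewrite inE -map_comp; apply/mapP/imsetP => [[e et ->]|].
    by exists (chamber e); rewrite ?inE ?map_f //= moveE.
  by case=> F; rewrite inE => /mapP [e et ->] ->; exists e; rewrite //= moveE.
split=> //; last exact: del_edges_iso.
by rewrite card_imset //; apply/imset_inj/bij_inj.
Qed.

(** * Reduction of admissible triples to six representatives *)

(** Call two edges opposite if they neither meet nor are joined by an edge. The numbers of opposite
    pairs in these triples are 0, 1, 1, 2, 3, 3; the first triple consists of alternate edges of a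
    hexagon. *)
Definition representatives : seq (seq (nat * nat)) :=
  [:: [:: (0, 1); (2, 3); (4, 5)];  [:: (0, 1); (2, 3); (4, 9)];
      [:: (0, 1); (2, 3); (6, 7)];  [:: (0, 1); (2, 3); (6, 11)];
      [:: (0, 1); (3, 4); (6, 7)];  [:: (0, 1); (3, 4); (6, 11)]].

Definition without_boundary (t : seq (nat * nat)) : bool :=
  all (fun x => 2 <= nat_valency t x) vertices.

Lemma move_first_arc (e : nat * nat) : e \in arcs ->
  exists2 s, s \in automorphisms & move s e = (0, 1).
Proof.
move=> eP.
have : all (fun e => has (fun s => move s e == (0, 1)) automorphisms) arcs.
  by vm_cast_no_check (erefl true).
by move=> /allP /(_ e eP) /hasP [s s_aut /eqP se]; exists s.
Qed.

(* One edge at each distance from {0, 1}: equal, meeting it, and the two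
   disjoint positions. *)
Definition second_arcs : seq (nat * nat) := [:: (0, 1); (1, 2); (2, 3); (3, 4)].

(** Since [move] reorients its result, [s] may exchange 0 and 1, that is, act as a duality of the
    plane. This is why one edge per distance suffices, whichever end of {0, 1} is nearer. *)
Lemma move_second_arc (e : nat * nat) : e \in arcs ->
  exists2 s, s \in automorphisms &
    move s (0, 1) = (0, 1) /\ move s e \in second_arcs.
Proof.
move=> eP; have : all (fun e => has (fun s =>
    (move s (0, 1) == (0, 1)) && (move s e \in second_arcs))
      automorphisms) arcs.
  by vm_cast_no_check (erefl true).
by move=> /allP /(_ e eP) /hasP [s s_aut /andP [/eqP s01 se]]; exists s.
Qed.

(** An inclusion in [r] ignores the order of the edges and also covers triples with repetitions; a
    cardinality argument later turns it into an equality. *)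
Lemma move_third_arc (e e' : nat * nat) :
  e \in second_arcs -> e' \in arcs -> without_boundary [:: (0, 1); e; e'] ->
  exists2 s, s \in automorphisms &
    exists2 r, r \in representatives &
      {subset map (move s) [:: (0, 1); e; e'] <= r}.
Proof.
move=> eP e'P t_bd.
have : all (fun e => all (fun e' => let t := [:: (0, 1); e; e'] in
    without_boundary t ==> has (fun s => has (fun r =>
      all (mem r) (map (move s) t)) representatives) automorphisms)
    arcs) second_arcs.
  by vm_cast_no_check (erefl true).
move=> /allP /(_ e eP) /allP /(_ e' e'P) /implyP /(_ t_bd).
by move=> /hasP [s s_aut /hasP [r rP /allP str]]; exists s => //; exists r.
Qed.

Lemma iso_without_boundary (t t' : seq (nat * nat)) :
  {subset t <= arcs} -> {subset t' <= arcs} ->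
  sgraph_iso (del_edges (chambers t)) (del_edges (chambers t')) ->
  (forall x : del_edges (chambers t), 2 <= valency x) -> without_boundary t'.
Proof.
move=> t_arcs t'_arcs [f f_bij fP] t_val; apply/allP => x.
rewrite mem_iota => /= x_lt; rewrite -[x]/(val (Ordinal x_lt)).
rewrite -(valency_del_chambers t'_arcs); case: (f_bij) => g _ fK.
by rewrite -(fK (Ordinal x_lt)) (valency_iso f_bij fP).
Qed.

Lemma representatives_arcs (r : seq (nat * nat)) :
  r \in representatives -> {subset r <= arcs}.
Proof.
by move=> rP; apply/allP; move: r rP; apply/allP; vm_compute.
Qed.

Lemma card_representative (r : seq (nat * nat)) :
  r \in representatives -> #|chambers r| = 3.
Proof.
move=> rP; have /allP/(_ r rP)/andP [/eqP r_size r_uniq] :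
  all (fun r => (size r == 3) && uniq r) representatives by vm_compute.
rewrite /chambers cardsE -r_size -(size_map chamber r); apply/card_uniqP.
rewrite map_inj_in_uniq // => e e' /(representatives_arcs rP) eP.
by move=> /(representatives_arcs rP); apply: chamber_inj.
Qed.

Lemma missing_heawood_representative (G : sgraph) : missing heawood 3 G ->
  exists2 r, r \in representatives & sgraph_iso G (del_edges (chambers r)).
Proof.
move=> [D [/edges_chambers [t [t_arcs t_size DE]]]].
rewrite {D}DE in t_size * => D3; rewrite D3 in t_size.
case: t t_arcs t_size D3 => [|e1 [|e2 [|e3 [|? ?]]]] // t_arcs _ D3 t_val Gt.
have [s1 s1_aut s1e] : exists2 s, s \in automorphisms & move s e1 = (0, 1).
  by apply/move_first_arc/t_arcs; rewrite mem_head.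
have [t1_arcs t1_card t_t1] := del_chambers_move s1_aut t_arcs.
move: t1_arcs t1_card t_t1; rewrite /= s1e.
move: (move s1 e2) (move s1 e3) => a b t1_arcs t1_card t_t1.
have [|s2 s2_aut [s2e s2a]] := @move_second_arc a.
  by apply: t1_arcs; rewrite !inE eqxx orbT.
have [t2_arcs t2_card t1_t2] := del_chambers_move s2_aut t1_arcs.
move: t2_arcs t2_card t1_t2 s2a; rewrite /= s2e.
move: (move s2 a) (move s2 b) => c d t2_arcs t2_card t1_t2 cP.
have t_t2 := sgraph_iso_trans t_t1 t1_t2.
have [||s3 s3_aut [r rP t3_r]] := @move_third_arc c d cP.
- by apply: t2_arcs; rewrite !inE eqxx !orbT.
- exact: iso_without_boundary t_t2 t_val.
have [t3_arcs t3_card t2_t3] := del_chambers_move s3_aut t2_arcs.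
exists r => //; apply: sgraph_iso_trans Gt _; apply: sgraph_iso_trans t_t2 _.
(* The moves preserve the number of deleted edges, so this is an inclusion between sets of three
   edges. *)
suff <- : chambers (map (move s3) [:: (0, 1); c; d]) = chambers r by [].
apply/eqP; rewrite eqEcard card_representative // t3_card t2_card t1_card D3.
rewrite andbT; apply/subsetP => E; rewrite !in_set => /mapP [e /t3_r er ->].
exact: map_f.
Qed.

Lemma representative_missing (r : seq (nat * nat)) : r \in representatives ->
  missing heawood 3 (del_edges (chambers r)).
Proof.
move=> rP; have r_arcs := representatives_arcs rP.
exists (chambers r); split.
- apply/subsetP => E; rewrite inE => /mapP [[x y] /r_arcs + ->].
  rewrite mem_arcs => /and3P [xy y_lt adj_xy]; have x_lt := ltn_trans xy y_lt.
  apply/imset2P; exists (inord x) (inord y) => //.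
  by rewrite inE /adj /= !inordK.
- exact: card_representative.
- have /allP/(_ r rP)/allP r_bd : all without_boundary representatives.
    by vm_compute.
  by move=> x; rewrite valency_del_chambers // r_bd // mem_vertices.
- by exists id; [exists id|].
Qed.

Lemma weight_representatives :
  map nat_weight representatives = [:: 30; 68; 62; 106; 180; 162].
Proof. by vm_compute. Qed.

(** * The Heawood graph as the incidence graph of the Fano plane *)

Definition bit (c j : nat) : bool := odd (c %/ 2 ^ j).

Definition binary_row (c : nat) : 'rV['F_2]_3 := (\row_(j < 3) (bit c j)%:R)%R.

(** Addition in the field with two elements is exclusive or, so orthogonality of coded vectors
    becomes a computation on bits. *)
Lemma binary_row_dot (c d : nat) :
  (binary_row c *m (binary_row d)^T == 0)%R =
  ~~ ((bit c 0 && bit d 0) (+) (bit c 1 && bit d 1) (+) (bit c 2 && bit d 2)).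
Proof.
set M := (_ *m _)%R; have -> : (M == 0)%R = (M ord0 ord0 == 0)%R.
  apply/eqP/eqP => [->|M0]; first by rewrite mxE.
  by apply/rowP => i; rewrite (ord1 i) M0 mxE.
rewrite mxE !big_ord_recl big_ord0 !mxE /=.
by do 3!case: (bit c _); do 3!case: (bit d _).
Qed.

Lemma binary_row_surj (u : 'rV['F_2]_3) : exists2 c, c < 8 & u = binary_row c.
Proof.
have uE j : u ord0 j = ((u ord0 j != 0)%:R)%R.
  by apply: val_inj; case: (u ord0 j) => [[|[|]]].
pose b j : bool := (u ord0 j != 0)%R.
exists (b (inord 0) + 2 * b (inord 1) + 4 * b (inord 2)).
  by case: (b _); case: (b _); case: (b _).
apply/rowP => j; rewrite uE mxE -/(b j) -[in b j](inord_val j); congr (_%:R)%R.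
by case: j => [[|[|[|//]]]] /= _; do 3!case: (b _).
Qed.

(* Vertex 2 a of [heawood] is the point spanned by the a-th vector of the first
   list, vertex 2 b + 1 the line orthogonal to the b-th vector of the second. *)
Definition point_codes : seq nat := [:: 1; 2; 4; 5; 7; 3; 6].
Definition line_codes : seq nat := [:: 4; 1; 2; 5; 3; 7; 6].

Lemma rank_binary_row (c : nat) : 0 < c < 8 -> \rank (binary_row c) = 1.
Proof.
move=> c_lt; rewrite rank_rV; suff -> : (binary_row c != 0)%R by [].
have : has (bit c) (iota 0 3).
  by case: c c_lt => [|[|[|[|[|[|[|[|]]]]]]]].
move=> /hasP [j]; rewrite mem_iota => /= j_lt cj.
by apply/eqP => /rowP /(_ (Ordinal j_lt)); rewrite !mxE /= cj.
Qed.

(** The default 1 is itself the code of a nonzero vector, so every index yields a point and a line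
    and [fano_vertex] is defined without bounds. *)
Lemma nth_codes (s : seq nat) (a : nat) :
  all (fun c => 0 < c < 8) s -> 0 < nth 1 s a < 8.
Proof.
move=> s_ok.
by have [/(all_nthP 1 s_ok)|/(nth_default 1) ->] := ltnP a (size s).
Qed.

Lemma rank_point (a : nat) : \rank (binary_row (nth 1 point_codes a)) = 1.
Proof. by rewrite rank_binary_row // nth_codes. Qed.

Lemma rank_line (b : nat) :
  \rank (kermx (binary_row (nth 1 line_codes b))^T) = 2.
Proof. by rewrite mxrank_ker mxrank_tr rank_binary_row // nth_codes. Qed.

Lemma gen_subspaceF2 (m d : nat) (A : 'M['F_2]_(m, 3)) : \rank A = d ->
  ((<<(<<A>>%MS : 'M_3)>>%MS == <<A>>%MS :> 'M_3) && (\rank <<A>> == d))%R.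
Proof. by move=> <-; rewrite genmx_id mxrank_gen !eqxx. Qed.

Definition subspace (m d : nat) (A : 'M['F_2]_(m, 3)) (Ad : \rank A = d) :
  subspaceF2 d := exist _ <<A>>%MS (gen_subspaceF2 Ad).

(** Matrices with the same row space have the same canonical generator, and an element of
    [subspaceF2] is its own generator. *)
Lemma subspace_eq (m d : nat) (A : 'M['F_2]_(m, 3)) (Ad : \rank A = d)
  (U : subspaceF2 d) : (val U :=: A)%MS -> U = subspace Ad.
Proof.
move=> UA; apply: val_inj; rewrite /= -(eq_genmx UA).
by case: U {UA} => U /= /andP [/eqP].
Qed.

Definition fano_vertex (x : heawood) : fano_graph :=
  if odd (val x) then inr (subspace (rank_line (val x)./2))
  else inl (subspace (rank_point (val x)./2)).

Lemma fano_vertex_adj (x y : heawood) :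
  adj (fano_vertex x) (fano_vertex y) = adj x y.
Proof.
have inc a b : a \in iota 0 7 -> b \in iota 0 7 ->
    (<<binary_row (nth 1 point_codes a)>> <=
     <<kermx (binary_row (nth 1 line_codes b))^T>>)%MS =
    arc_LCF a.*2 b.*2.+1.
  move=> aP bP; rewrite !genmxE sub_kermx binary_row_dot.
  (* Incidence is now orthogonality of two codes, compared with [arc_LCF] for all 49 pairs. *)
  apply/eqP; move: b bP; apply/allP; move: a aP; apply/allP.
  by vm_compute.
have half_lt (z : 'I_14) : z./2 \in iota 0 7.
  by rewrite mem_iota /= ltn_half_double ltn_ord.
have evenE n : odd n = false -> n./2.*2 = n.
  by move=> n_even; rewrite -[RHS]odd_double_half n_even.
have oddE n : odd n -> n./2.*2.+1 = n.
  by move=> n_odd; rewrite -[RHS]odd_double_half n_odd.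
rewrite /fano_vertex [RHS]/adj /= /heawood_adj.
case xP: (odd (val x)); case yP: (odd (val y)) => //=.
- by rewrite /adj /= inc // evenE // oddE.
- by rewrite /adj /= inc // evenE // oddE.
Qed.

(** A point is spanned by a nonzero vector, and a line is the orthogonal of a nonzero vector; both
    code lists contain all of 1 to 7. *)
Lemma fano_vertex_surj (y : fano_graph) : exists x, fano_vertex x = y.
Proof.
have code (s : seq nat) c : c \in s -> size s = 7 ->
    exists2 a, a < 7 & nth 1 s a = c.
  by move=> cs <-; exists (index c s); rewrite ?index_mem ?nth_index.
have row_code (s : seq nat) (u : 'rV['F_2]_3) :
    (u != 0)%R -> all (fun c => c \in s) (iota 1 7) -> size s = 7 ->
    exists2 a, a < 7 & u = binary_row (nth 1 s a).
  have [c c_lt ->] := binary_row_surj u => c_neq0 /allP s_all s7.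
  have [|a a_lt sa] := @code s c _ s7; last by exists a; rewrite ?sa.
  apply: s_all; rewrite mem_iota c_lt andbT lt0n.
  apply: contra c_neq0 => /eqP ->.
  by apply/eqP/rowP => j; rewrite !mxE /bit div0n.
have row_base_rank1 (m : nat) (A : 'M['F_2]_(m, 3)) : \rank A = 1 ->
    exists2 u : 'rV_3, (u != 0)%R & (A :=: u)%MS.
  move=> A1; exists (castmx (A1, erefl) (row_base A)).
    by rewrite -mxrank_eq0 (eqmx_cast _ _) eq_row_base A1.
  by apply: eqmx_sym; apply: eqmx_trans (eqmx_cast _ _) (eq_row_base A).
case: y => U.
- have [|u u_neq0 Uu] := row_base_rank1 _ (val U).
    by case: U => U /= /andP [_ /eqP].
  have [||a a_lt uE] := row_code point_codes u u_neq0; [by [] | by [] |].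
  have x_lt : a.*2 < 14 by rewrite -[14]/(7.*2) ltn_double.
  exists (Ordinal x_lt); rewrite /fano_vertex /= odd_double; congr inl.
  by apply/esym/subspace_eq; rewrite doubleK -uE.
- have U2 : \rank (val U) = 2 by case: U => U /= /andP [_ /eqP].
  (* [u] spans the orthogonal complement of [U], which has rank 3 - 2 = 1. *)
  have [|u u_neq0 Uu] := row_base_rank1 _ (kermx (val U)^T).
    by rewrite mxrank_ker mxrank_tr U2.
  have [||b b_lt uE] := row_code line_codes u u_neq0; [by [] | by [] |].
  have x_lt : b.*2.+1 < 14 by rewrite -doubleS -[14]/(7.*2) leq_double.
  exists (Ordinal x_lt); rewrite /fano_vertex /= odd_double /=; congr inr.
  apply/esym/subspace_eq; rewrite /= uphalf_double -uE.
  (* [U] lies in the orthogonal of [u], by transposing the orthogonality of [u] to [U]; both have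
     rank 2, so they coincide. *)
  apply/eqmxP; rewrite -(geq_leqif (mxrank_leqif_eq _)); last first.
    apply/sub_kermxP/trmx_inj; rewrite trmx_mul trmxK trmx0.
    by apply/sub_kermxP; rewrite Uu.
  by rewrite U2 uE rank_line.
Qed.

Lemma heawood_fano : sgraph_iso heawood fano_graph.
Proof.
exists fano_vertex; last exact: fano_vertex_adj.
apply: inj_card_bij.
  move=> x y xy; apply: heawood_twin_free => z.
  by have := fano_vertex_adj x z; rewrite xy fano_vertex_adj => yz; apply: esym.
(* Surjectivity enters only as a bound on the number of vertices of [fano_graph], so no inverse is
   constructed. *)
apply: leq_trans (leq_image_card fano_vertex _); apply: subset_leq_card.
by apply/subsetP => y _; have [x <-] := fano_vertex_surj y; apply: codom_f.
Qed.

Theorem proposition0p5 :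
  exists B : 'I_6 -> sgraph,
    [/\ forall i : 'I_6, A2_building_missing 3 (B i),
        forall i j : 'I_6, sgraph_iso (B i) (B j) -> i = j
      & forall G : sgraph, A2_building_missing 3 G ->
          exists i : 'I_6, sgraph_iso G (B i)].
Proof.
pose rep (i : 'I_6) := nth [::] representatives i.
have repP i : rep i \in representatives by rewrite mem_nth.
exists (fun i => del_edges (chambers (rep i))); split=> [i|i j ij|G].
- exact: missing_iso heawood_fano (representative_missing (repP i)).
(* Isomorphic graphs have equal weights, and the list of the six weights has no repetition. *)
- have := weight_iso ij.
  rewrite !weight_del_chambers; try exact: representatives_arcs.
  rewrite /rep -!(nth_map _ 0) // weight_representatives => /eqP.
  by rewrite nth_uniq // => /eqP /val_inj.
- move=> /(missing_iso (sgraph_iso_sym heawood_fano)).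
  move=> /missing_heawood_representative [r rP Gr].
  have r_lt : index r representatives < 6 by rewrite index_mem.
  by exists (Ordinal r_lt); rewrite /rep nth_index.
Qed.
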